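(* Let $0<r<1$. For $n\ge1$ let $T_n=\{-1,1\}^n\subset\mathbb{R}^n$, and let $(X_k)_{k\ge1}$ be independent symmetric real random variables with tails $\mathbf{P}(|X_k|>u)=\exp(-u^r)$ for $u>0$. Then $$\lim_{n\to\infty}\frac{\gamma_r(T_n,d_\infty)}{\mathbf{E}\sup_{t\in T_n}\sum_{k=1}^n t_kX_k}=+\infty .$$ Consequently, there is no constant $L(r)<\infty$ depending only on $r$ such that $$\gamma_r(T,d_\infty)\le L(r)\,\mathbf{E}\sup_{t\in T}\sum_{k=1}^n t_kX_k$$ holds for all $n\ge1$ and all nonempty $T\subset\mathbb{R}^n$.
   Context: For an index set $T$, $\mathbf{E}\sup_{t\in T}X_t:=\sup\{\mathbf{E}\sup_{t\in S}X_t : S\subset T \text{ finite (nonempty)}\}$. $d_\infty$ is the metric on $\mathbb{R}^n$ induced by $\|x\|_\infty=\max_k|x_k|$. A sequence of partitions $(\mathcal{A}_j)_{j\ge0}$ of a set $T$ is increasing if for every $j$ and every $B\in\mathcal{A}_{j+1}$ there is $A\in\mathcal{A}_j$ with $B\subset A$; it is admissible if it is increasing, $\mathcal{A}_0=\{T\}$ and $|\mathcal{A}_j|\le 2^{2^j}$ for all $j$. For $t\in T$, $A_j(t)$ is the unique element of $\mathcal{A}_j$ containing $t$. For $\alpha>0$ and a metric space $(T,d)$, $$\gamma_\alpha(T,d)=\inf\sup_{t\in T}\sum_{j\ge0}2^{j/\alpha}\Delta_d(A_j(t)),$$ where $\Delta_d(A)$ is the $d$-diameter of $A$ and the infimum is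 over all admissible sequences of partitions of $T$. *)

(* Defs.v *)
From HB Require Import structures.
From mathcomp Require Import all_boot all_order all_algebra.
From mathcomp Require Import finmap.
From mathcomp Require Import all_classical all_reals all_analysis.

Set Implicit Arguments.
Unset Strict Implicit.
Unset Printing Implicit Defensive.

Import Order.TTheory GRing.Theory Num.Theory.
Import numFieldNormedType.Exports.

Local Open Scope classical_set_scope.
Local Open Scope ring_scope.
Local Open Scope ereal_scope.

Section Chaining.
Context {R : realType} {U : Type}.

(* Index sets and partition blocks are sets in an ambient type [U], and [d] is
   the distance on [U]; unbounded sets have diameter [+oo]. *)
Definition diam (d : U -> U -> R) (A : set U) : \bar R :=
  ereal_sup [set (d x y)%:E | x in A & y in A].

Definition increasing_partitions (T : set U) (AA : nat -> set (set U)) : Prop :=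
  (forall j, partition (AA j) id T) /\
  (forall j B, AA j.+1 B -> exists2 A, AA j A & B `<=` A).

Definition admissible (T : set U) (AA : nat -> set (set U)) : Prop :=
  [/\ increasing_partitions T AA,
      AA 0%N = [set T] &
      forall j, (AA j #<= `I_(2 ^ (2 ^ j)))%card].

(* [pblock (AA j) id t] is the block of [AA j] containing [t]. *)
Definition gamma (alpha : R) (T : set U) (d : U -> U -> R) : \bar R :=
  ereal_inf
    [set ereal_sup [set \sum_(0 <= j <oo)
                          (2 `^ (j%:R / alpha))%:E * diam d (pblock (AA j) id t)
                   | t in T]
    | AA in admissible T].

End Chaining.

(* The norm of ['rV[R]_n] is the maximum of the absolute values of the entries
   (see [mx_normrE]). *)
Definition d_infty {R : realType} {n : nat} (x y : 'rV[R]_n) : R := `|x - y|%R.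

(* [E sup_(t in T) X_t], as the supremum over finite nonempty subsets; the inner
   [sup] is a maximum. *)
Definition Esup {d : measure_display} {Omega : measurableType d} {R : realType}
    (P : probability Omega R) {U : Type} (T : set U) (X : U -> Omega -> R) :
    \bar R :=
  ereal_sup [set 'E_P[fun w => sup [set X t w | t in S]]
            | S in [set S | [/\ finite_set S, S !=set0 & S `<=` T]]].

Section RandomVariables.
Context {d : measure_display} {Omega : measurableType d} {R : realType}
  {P : probability Omega R}.

Definition mutually_independent {I : choiceType} (X : I -> {RV P >-> R}) : Prop :=
  forall (J : {fset I}) (B : I -> set R), (forall k, measurable (B k)) ->
    P (\bigcap_(k in [set` J]) (X k @^-1` B k)) =
    \prod_(k <- J) P (X k @^-1` B k).

Definition symmetric_RV (X : {RV P >-> R}) : Prop :=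
  forall B : set R, measurable B ->
    P (X @^-1` B) = P ((fun w => - X w)%R @^-1` B).

(* The index [k < n] stands for [k + 1]: [X 0, X 1, ...] are the variables
   usually numbered [X_1, X_2, ...]. *)
Definition canonical_process (X : nat -> {RV P >-> R}) (n : nat)
    (t : 'rV[R]_n) (w : Omega) : R :=
  (\sum_(k < n) t ord0 k * X k w)%R.

End RandomVariables.

Definition hypercube (R : realType) (n : nat) : set 'rV[R]_n :=
  [set t : 'rV[R]_n | forall k, t ord0 k = (-1)%R \/ t ord0 k = 1%R].
Arguments hypercube : clear implicits.

(* Main.v *)
Require Import Defs.
From HB Require Import structures.
From mathcomp Require Import all_boot all_order all_algebra.
From mathcomp Require Import finmap.
From mathcomp Require Import all_classical all_reals all_analysis.
From mathcomp Require Import measurable_realfun.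

Set Implicit Arguments.
Unset Strict Implicit.
Unset Printing Implicit Defensive.

Import Order.TTheory GRing.Theory Num.Theory.
Import numFieldNormedType.Exports.

Local Open Scope classical_set_scope.
Local Open Scope ring_scope.

(** Distinct points of the cube are at distance 2, and the cube has [2 ^ n]
    points, so by pigeonhole every partition into at most [2 ^ (2 ^ j)] blocks
    with [2 ^ j < n] has a block of diameter 2.  The single term of index [j] of
    the chaining sum, for the largest such [j], already has order [n^(1/r)].
    On the other side the supremum over the cube is at most [\sum_k |X_k|], whose
    expectation is [O(n)] because the tails make [E|X_k|] bounded.  As [1/r > 1],
    the ratio diverges. *)

Lemma set_inj_card_le {T U : Type} (f : T -> U) (A : set T) (B : set U) :
  set_inj A f -> (forall x, A x -> B (f x)) -> (A #<= B)%card.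
Proof.
move=> fI fAB; rewrite -(card_le_eql (inj_card_eq fI)).
by apply: subset_card_le => _ [x Ax <-]; exact: fAB.
Qed.

(** * Chaining lower bound for separated sets *)

Section GammaLowerBound.
Context {R : realType} {U : Type}.
Implicit Types (d : U -> U -> R) (T A : set U) (AA : nat -> set (set U)).

Lemma pblockP (B : set (set U)) T t :
  partition B id T -> T t -> B (pblock B id t) /\ pblock B id t t.
Proof.
move=> [<- _ _] [A BA At]; rewrite /pblock /pblock_index.
by apply: (@getPex _ [set A | B A /\ A t]); exists A.
Qed.

Lemma diam_ge d A x y : A x -> A y -> ((d x y)%:E <= diam d A)%E.
Proof. by move=> Ax Ay; apply: ereal_sup_ubound; exists x => //; exists y. Qed.

Lemma gamma_ge_card (alpha delta : R) (j : nat) T d :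
  (forall x y, 0 <= d x y) ->
  (forall x y, T x -> T y -> x <> y -> delta <= d x y) ->
  ~~ (T #<= `I_(2 ^ (2 ^ j)))%card ->
  ((2 `^ (j%:R / alpha) * delta)%:E <= gamma alpha T d)%E.
Proof.
move=> d0 dT Tj; apply: le_ereal_inf_tmp => _ [AA [[AAp _] _ AAc]] <-.
(* The diameter of the empty set is [-oo], so nonnegativity has to use a point of the block: [t]
   itself. *)
have diam0 t i : T t -> (0 <= diam d (pblock (AA i) id t))%E.
  move=> Tt; have [_ tt] := pblockP (AAp i) Tt.
  by apply: le_trans (diam_ge d tt tt); rewrite lee_fin.
have [x [y [Tx Ty xy Exy]]] : exists x y, [/\ T x, T y, x <> y &
    pblock (AA j) id x = pblock (AA j) id y].
  apply: contrapT => nxy; move/negP: Tj; apply.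
  apply: card_le_trans (AAc j).
  apply: (set_inj_card_le (f := pblock (AA j) id)).
    move=> x y /set_mem Tx /set_mem Ty Exy; apply: contrapT => xy.
    by apply: nxy; exists x, y.
  by move=> t Tt; have [] := pblockP (AAp j) Tt.
apply: le_trans (ereal_sup_ubound _); last by exists x.
(* Stopping the sum at [j.+1] makes the term of index [j] the last one; the earlier ones are
   nonnegative and dropped. *)
apply: le_trans (nneseries_lim_ge j.+1 _); last first.
  by move=> i _ _; rewrite mule_ge0 ?diam0// lee_fin powR_ge0.
rewrite big_nat_recr//=; apply: le_trans (leeDr _ _); last first.
  by apply: sume_ge0 => i _; rewrite mule_ge0 ?diam0// lee_fin powR_ge0.
rewrite EFinM lee_wpmul2l ?lee_fin ?powR_ge0//.
have [_ xx] := pblockP (AAp j) Tx; have [_ yy] := pblockP (AAp j) Ty.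
by apply: le_trans (@diam_ge d _ x y xx _); rewrite ?lee_fin ?dT// Exy.
Qed.

End GammaLowerBound.

(** * Size and separation of the cube *)

Section Hypercube.
Context {R : realType}.

Lemma hypercube_card_ge n : (`I_(2 ^ n) #<= hypercube R n)%card.
Proof.
have cN : #|{ffun 'I_n -> bool}| = (2 ^ n)%N.
  by rewrite card_ffun card_bool card_ord.
rewrite -cN (card_le_eql card_II).
pose f (k : 'I_#|{ffun 'I_n -> bool}|) : 'rV[R]_n :=
  \row_i (-1) ^+ (enum_val k i).
apply: (set_inj_card_le (f := f)) => [k l _ _ fkl|k _ i].
  apply: enum_val_inj; apply/ffunP => i.
  by have /matrixP/(_ ord0 i) := fkl; rewrite !mxE => /signr_inj.
by rewrite mxE; case: (enum_val k i); [left|right]; rewrite ?expr1 ?expr0.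
Qed.

Lemma hypercube_d_infty n (x y : 'rV[R]_n) :
  hypercube R n x -> hypercube R n y -> x <> y -> 2 <= d_infty x y.
Proof.
move=> Hx Hy xy.
have [i xyi] : exists i, x ord0 i <> y ord0 i.
  apply: contrapT => nxy; apply: xy; apply/rowP => i.
  by apply: contrapT => xyi; apply: nxy; exists i.
rewrite /d_infty /Num.norm/= mx_normrE; apply: le_trans (le_bigmax _ _ (ord0, i)).
rewrite /= !mxE; case: (Hx i) (Hy i) xyi => -> [] -> // _.
  by rewrite -opprD normrN ger0_norm.
by rewrite opprK ger0_norm.
Qed.

Lemma gamma_hypercube_ge (alpha : R) n : 0 < alpha -> (1 < n)%N ->
  (((n%:R / 2) `^ alpha^-1 * 2)%:E <= gamma alpha (hypercube R n) d_infty)%E.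
Proof.
(* The logarithm of [n.-1] gives [2 ^ j < n <= 2 ^ j.+1]: the strict side lets the cube outnumber
   the blocks, the other side gives [n / 2 <= 2 ^ j]. *)
move=> a0 n1; set j := trunc_log 2 n.-1.
have n1_gt0 : (0 < n.-1)%N by case: n n1 {j} => [|[]].
have /andP[jn nj] := trunc_log_bounds (isT : (1 < 2)%N) n1_gt0.
rewrite prednK ?(ltnW n1)// in nj.
apply: le_trans (@gamma_ge_card _ _ alpha 2 j _ _ _ (@hypercube_d_infty n) _); first last.
- apply/negP => /(card_le_trans (hypercube_card_ge n)).
  rewrite card_le_II leq_exp2l// leqNgt -/j.
  by rewrite (leq_ltn_trans jn)// ltn_predL ltnW.
- by move=> x y; exact: normr_ge0.
rewrite lee_fin ler_wpM2r// powRrM powR_mulrn// ge0_ler_powR//.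
- by rewrite invr_ge0 ltW.
- by rewrite nnegrE divr_ge0.
- by rewrite nnegrE.
by rewrite ler_pdivrMr// -exprSr -natrX ler_nat.
Qed.

End Hypercube.

Section Integral.
Context {d : measure_display} {T : measurableType d} {R : realType}
  (mu : measure T R).

(* No measurability of [f]: in [Esup], suprema of random variables are integrated
   without being known to be measurable. *)
Lemma le_integral_ge0_nomeas (f g : T -> \bar R) :
  (forall x, 0 <= g x)%E -> (forall x, f x <= g x)%E ->
  (\int[mu]_x f x <= \int[mu]_x g x)%E.
Proof.
move=> g0 fg; rewrite integralE.
apply: (@le_trans _ _ (\int[mu]_x f^\+ x)%E).
  rewrite -[leRHS]adde0 leeD2l// oppe_le0.
  by apply: integral_ge0 => x _; exact: funeneg_ge0.
(* Both integrals are now suprema over simple functions lying below the integrand, and this is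
   monotone in the integrand. *)
rewrite !ge0_integralTE//; apply: ereal_sup_le => _ [h hf <-]; exists h => //= x.
by apply: le_trans (hf x) _; rewrite funeposE ge_max fg g0.
Qed.

End Integral.

(** * Tail estimates and the first moment *)

Section Tail.
Context {R : realType}.

(** With [x = 2 ^ (k * r)], the bound [expR x >= (x / N) ^ N] gives [4 ^ k] as soon as [r * N >= 2].
    Decay of order [4 ^ k] is asked for because the tails get weighted by [2 ^ k]. *)
Lemma expRN_powR2_le (r : R) : 0 < r ->
  exists2 K : R, 0 <= K &
    forall k : nat, expR (- ((2 ^+ k) `^ r)) <= K / 4 ^+ k.
Proof.
move=> r0; pose N := (Num.truncn (2 / r)).+1.
have rN : 2 <= r * N%:R by rewrite mulrC -ler_pdivrMr// ltW// truncnS_gt.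
exists (N%:R ^+ N) => [|k]; first by rewrite exprn_ge0.
set x : R := (2 ^+ k) `^ r.
have x0 : 0 <= x by exact: powR_ge0.
rewrite expRN -[leRHS]invf_div lef_pV2 ?posrE ?expR_gt0//; last first.
  by rewrite divr_gt0 ?exprn_gt0// ltr0n.
apply: (@le_trans _ _ ((x / N%:R) ^+ N)).
  rewrite expr_div_n ler_wpM2r ?invr_ge0 ?exprn_ge0//.
  rewrite /x -!(powR_mulrn k)// -(powR_mulrn N) ?powR_ge0// -!powRrM.
  have -> : 4 = 2 `^ 2 :> R by rewrite powR_mulrn// -natrX.
  rewrite -powRrM ler_powR ?ler1n// mulrC.
  by rewrite ler_wpM2l.
have -> : x = N%:R * (x / N%:R) by rewrite mulrCA divff ?mulr1// pnatr_eq0.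
rewrite mulrAC divff ?pnatr_eq0// mul1r expRM_natl lerXn2r ?nnegrE ?expR_ge0//.
  by rewrite divr_ge0.
by apply: le_trans (expR_ge1Dx _); rewrite lerDr.
Qed.

Lemma norm_le_dyadic (x : R) :
  `|x| <= 2 \/ exists k, 2 ^+ k < `|x| /\ `|x| <= 4 * 2 ^+ k.
Proof.
have [|x2] := leP `|x| 2; [by left|right].
have t1 : (1 < Num.truncn `|x|)%N by rewrite truncn_gt_nat ltW.
have /andP[] := trunc_log_bounds (isT : (1 < 2)%N) (ltnW t1).
have : (0 < trunc_log 2 (Num.truncn `|x|))%N by rewrite trunc_log_gt0.
case: (trunc_log _ _) => // k _; rewrite truncn_ge_nat// truncn_lt_nat// => kx xk.
(* The logarithm is [k.+1]; giving up one factor 2 makes the lower bound strict, as in the tail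
   events. *)
exists k; split; last by rewrite -natrX -natrM -(expnD 2 2) ltW.
by rewrite (lt_le_trans _ kx)// natrX ltr_eXn2l// ltr1n.
Qed.

End Tail.

Section Moment.
Context {d : measure_display} {Omega : measurableType d} {R : realType}
  (P : probability Omega R).

(** The constant is fixed before [X], so that one bound serves all coordinates. *)
Lemma integral_norm_le_of_tail (r : R) : 0 < r ->
  exists2 C : R, 0 < C & forall X : {RV P >-> R},
    (forall u : R, 0 < u -> P [set w | u < `|X w|] = (expR (- (u `^ r)))%:E) ->
    (\int[P]_w `|X w|%:E <= C%:E)%E.
Proof.
move=> r0; have [K K0 HK] := expRN_powR2_le r0.
(* Integrate [|X| <= 2 + \sum_k 4 * 2^k * 1_{|X| > 2^k}]. *)
exists (2 + 2 * (4 * K)) => [|X Xt]; first by rewrite ltr_pwDl// !mulr_ge0.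
pose A k : set Omega := [set w | 2 ^+ k < `|X w|].
have mX : measurable_fun setT (fun w => `|X w|).
  by apply: measurableT_comp => //; exact: measurable_funPT.
have mA k : measurable (A k).
  rewrite -[A k]setTI; have -> : A k = (fun w => `|X w|) @^-1` `]2 ^+ k, +oo[.
    by apply/seteqP; split => w /=; rewrite in_itv/= andbT.
  exact: mX.
pose f k w : \bar R := ((4 * 2 ^+ k)%:E * (\1_(A k) w)%:E)%E.
have f0 k w : (0 <= f k w)%E by rewrite mule_ge0 ?lee_fin.
have mf k : measurable_fun [set: Omega] (f k).
  by apply: measurable_funeM; apply/measurable_EFinP; exact: measurable_indic.
apply: (@le_trans _ _ (\int[P]_w (2%:E + \sum_(0 <= k <oo) f k w))%E).
  apply: le_integral_ge0_nomeas => w.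
    by rewrite adde_ge0// nneseries_ge0.
  have [x2|[k [kx xk]]] := norm_le_dyadic (X w).
    by rewrite (@le_trans _ _ 2%:E) ?lee_fin// leeDl// nneseries_ge0.
  apply: (@le_trans _ _ (f k w)).
    by rewrite /f indicE mem_set// mule1 lee_fin.
  apply: (@le_trans _ _ (\sum_(0 <= k <oo) f k w)%E); last by rewrite leeDr.
  apply: le_trans (nneseries_lim_ge k.+1 _) => //.
  by rewrite big_nat_recr//= leeDr// sume_ge0.
rewrite ge0_integralD//; last 2 first.
- by move=> w _; exact: nneseries_ge0.
- by apply: ge0_emeasurable_sum => // k w _ _; exact: f0.
rewrite integral_cst// [X in (_ * X + _)%E](@probability_setT _ _ _ P) mule1 integral_nneseries//.
rewrite (EFinD 2) leeD2l//.
(* Term [k] is at most [4 * 2^k * K / 4^k = 2 * (4 * K) / 2^(k+1)], a geometric series with sum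
   [2 * (4 * K)]. *)
have geo := cvg_lim (@ereal_hausdorff R)
  (@cvg_geometric_eseries_half R (2 * (4 * K)) 0%N).
rewrite expr0 divr1 in geo; rewrite -geo.
apply: lee_nneseries => [k _ _|k _]; first exact: integral_ge0.
rewrite ge0_integralZl//; last first.
  by apply/measurable_EFinP; exact: measurable_indic.
rewrite integral_indic// setIT [X in (_ * X)%E](Xt (2 ^+ k)) ?exprn_gt0//.
rewrite -EFinM lee_fin.
apply: (@le_trans _ _ (4 * 2 ^+ k * (K / 4 ^+ k))).
  by rewrite ler_wpM2l// HK.
have -> : (4 : R) ^+ k = 2 ^+ k * 2 ^+ k by rewrite -exprMn -natrM.
have a0 : (2 : R) ^+ k != 0 by rewrite expf_neq0.
rewrite addn1 natrX exprS mulrACA invfM [_ * (_ / _)]mulrA mulfV// mul1r.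
by rewrite -mulf_div divff// mul1r.
Qed.

End Moment.

(** * Expected supremum over the cube *)

Section Process.
Context {d : measure_display} {Omega : measurableType d} {R : realType}
  {P : probability Omega R} (X : nat -> {RV P >-> R}).

Lemma canonical_process_le n (t : 'rV[R]_n) w : hypercube R n t ->
  canonical_process X t w <= \sum_(k < n) `|X k w|.
Proof.
move=> Ht; apply: ler_sum => k _; apply: le_trans (ler_norm _) _.
by rewrite normrM; case: (Ht k) => ->; rewrite ?normrN normr1 mul1r.
Qed.

Lemma Esup_hypercube_le n (C : R) :
  (forall k, \int[P]_w `|X k w|%:E <= C%:E)%E ->
  (Esup P (hypercube R n) (canonical_process X (n:=n)) <= (C * n%:R)%:E)%E.
Proof.
move=> XC; apply: ge_ereal_sup => _ [S [_ S0 ST] <-].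
rewrite expectation.unlock.
apply: (@le_trans _ _ (\int[P]_w \sum_(k < n) `|X k w|%:E)%E).
  apply: le_integral_ge0_nomeas => w; first by apply: sume_ge0.
  rewrite sumEFin lee_fin; apply: ge_sup => [|_ [t St <-]].
    by case: S0 => t St; exists (canonical_process X t w), t.
  by apply: canonical_process_le; exact: ST.
rewrite ge0_integral_sum//; last first.
  by move=> k; apply/measurable_EFinP; exact: measurableT_comp.
apply: (@le_trans _ _ (\sum_(k < n) C%:E)%E); first exact: lee_sum.
by rewrite sumEFin sumr_const card_ord mulr_natr.
Qed.

(** The cube contains some [t] together with [- t], and the larger of [X_t] and [- X_t] is
    nonnegative. *)
Lemma Esup_hypercube_ge0 n :
  (0 <= Esup P (hypercube R n) (canonical_process X (n:=n)))%E.
Proof.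
pose t : 'rV[R]_n := const_mx 1.
have Ht : hypercube R n t by move=> k; right; rewrite mxE.
have HNt : hypercube R n (- t) by move=> k; left; rewrite !mxE.
pose S := [set t; - t].
have SH : S `<=` hypercube R n by move=> _ [->|->].
apply: le_ereal_sup_tmp.
exists ('E_P[fun w => sup [set canonical_process X s w | s in S]])%E.
  by exists S => //; split; [exact: finite_set2|exists t; left|].
apply: expectation_ge0 => w.
have ub s : S s ->
    canonical_process X s w <= sup [set canonical_process X s w | s in S].
  move=> Ss; apply: ub_le_sup; last by exists s.
  (* A real [sup] is meaningful only for a set bounded above, hence this explicit bound. *)
  exists (\sum_(k < n) `|X k w|) => _ [u /SH Hu <-].
  exact: canonical_process_le.
have NXt : canonical_process X (- t) w = - canonical_process X t w.
  by rewrite /canonical_process -sumrN; apply: eq_bigr => k _; rewrite mxE mulNr.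
have [Xt|Xt] := leP 0 (canonical_process X t w).
  by apply: le_trans (ub t _) => //; left.
by apply: le_trans (ub (- t) _); [rewrite NXt oppr_ge0 ltW|right].
Qed.

End Process.

(** * Superlinear growth and conclusion *)

Lemma near_mulr_le_powR {R : realType} (K p : R) : 1 < p ->
  \forall n \near \oo, K * n%:R <= n%:R `^ p.
Proof.
move=> p1; near=> n.
have q0 : 0 < p - 1 by rewrite subr_gt0.
rewrite -mulr_powRB1 ?(lt_trans ltr01)// mulrC ler_wpM2l//.
apply: le_trans (ler_norm K) _.
(* The threshold on [n] is the root of [|K|] of order [p - 1]. *)
have -> : `|K| = (`|K| `^ (p - 1)^-1) `^ (p - 1).
  by rewrite -powRrM mulVf ?gt_eqF// powRr1.
apply: ge0_ler_powR; rewrite ?nnegrE ?powR_ge0// ?(ltW q0)//.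
by near: n; exact: nbhs_infty_ger.
Unshelve. all: by end_near. Qed.

Lemma near_lt_gamma_hypercube {R : realType} (r K : R) : 0 < r -> r < 1 ->
  \forall n \near \oo,
    ((K * n%:R)%:E < gamma r (hypercube R n) d_infty)%E.
Proof.
move=> r0 r1; near=> n.
have n1 : (1 < n)%N by near: n; exact: nbhs_infty_ge.
apply: lt_le_trans (gamma_hypercube_ge r0 n1); rewrite lte_fin.
rewrite powRM ?invr_ge0//; set c := 2^-1 `^ _.
have c0 : 0 < c by rewrite powR_gt0 ?invr_gt0.
have nK : (`|K| + 1) / c * n%:R <= n%:R `^ r^-1.
  by near: n; apply: near_mulr_le_powR; rewrite invf_gt1.
rewrite mulrAC ler_pdivrMr// in nK.
have n0 : 0 < n%:R :> R by rewrite ltr0n ltnW.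
apply: (@lt_le_trans _ _ ((`|K| + 1) * n%:R)).
  by rewrite ltr_pM2r// (le_lt_trans (ler_norm K))// ltrDl.
by apply: le_trans nK _; rewrite ler_peMr ?ler1n// mulr_ge0 ?powR_ge0.
Unshelve. all: by end_near. Qed.

Theorem mainTheorem2 (R : realType) (r : R) (r_gt0 : 0 < r) (r_lt1 : r < 1)
    (d : measure_display) (Omega : measurableType d) (P : probability Omega R)
    (X : nat -> {RV P >-> R})
    (X_indep : mutually_independent X)
    (X_sym : forall k, symmetric_RV (X k))
    (X_tail : forall k (u : R), 0 < u ->
       P [set w | u < `|X k w|] = (expR (- (u `^ r)))%:E) :
  ((gamma r (hypercube R n) d_infty /
      Esup P (hypercube R n) (canonical_process X (n:=n)))%E
     @[n --> \oo] --> +oo%E) /\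
  ~ (exists L : R, forall n : nat, (1 <= n)%N ->
       forall T : set 'rV[R]_n, T !=set0 ->
       (gamma r T d_infty <= L%:E * Esup P T (canonical_process X (n:=n)))%E).
Proof.
have [C C0 HC] := integral_norm_le_of_tail P r_gt0.
have EC n : (Esup P (hypercube R n) (canonical_process X (n:=n)) <=
    (C * n%:R)%:E)%E.
  by apply: Esup_hypercube_le => k; apply: HC; exact: X_tail.
split.
  apply/cvgeyPgey; near=> A; near=> n.
  have A0 : 0 <= A by near: A; exact: nbhs_pinfty_ge.
  have gA : ((A * C * n%:R)%:E < gamma r (hypercube R n) d_infty)%E.
    by near: n; exact: near_lt_gamma_hypercube.
  have := Esup_hypercube_ge0 (P := P) X n; have := EC n.
  case: (Esup _ _ _) => [e|//|//]; rewrite !lee_fin => eC e0.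
  (* The inverse of 0 is [+oo], so for [e = 0] the ratio is [+oo] because [gamma] is positive. *)
  have [e_eq0|e_neq0] := eqVneq e 0.
    rewrite e_eq0 inve0 gt0_muley ?leey//.
    by apply: le_lt_trans gA; rewrite lee_fin !mulr_ge0// ltW.
  rewrite inver (negbTE e_neq0) lee_pdivlMr ?lt0r ?e_neq0//.
  by apply: le_trans (ltW gA); rewrite -EFinM lee_fin -mulrA ler_wpM2l.
move=> [L HL].
near \oo => n.
have n1 : (1 <= n)%N by near: n; exact: nbhs_infty_ge.
(* [L] may be negative; passing to its absolute value only weakens the assumed bound, since the
   expected supremum is nonnegative. *)
have gL : ((`|L| * C * n%:R)%:E < gamma r (hypercube R n) d_infty)%E.
  by near: n; exact: near_lt_gamma_hypercube.
have H0 : hypercube R n !=set0 by exists (const_mx 1) => k; right; rewrite mxE.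
have := lt_le_trans gL (HL n n1 _ H0); apply/negP; rewrite -leNgt.
apply: (@le_trans _ _ (`|L|%:E *
    Esup P (hypercube R n) (canonical_process X (n:=n)))%E).
  by rewrite lee_wpmul2r ?Esup_hypercube_ge0// lee_fin ler_norm.
by rewrite -mulrA EFinM lee_wpmul2l// EC.
Unshelve. all: by end_near. Qed.
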